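(* Let $\Gamma$ be a finite simplicial graph with associated right-angled Artin group $A_\Gamma$, and let $\phi\in \mathrm{Out}(A_\Gamma)$ be a non-identity element of finite order. Then $\phi$ acts non-trivially on $H_1(A_\Gamma)$. In particular, $\mathcal{I}(A_\Gamma)$ is torsion-free.
   Context: For a finite simplicial graph $\Gamma$ with vertices $v_1,\dots,v_n$, the right-angled Artin group $A_\Gamma$ is the group generated by $v_1,\dots,v_n$ subject to the relations $[v_i,v_j]=1$ whenever $v_i,v_j$ are joined by an edge of $\Gamma$. $H_1(A_\Gamma)\cong\mathbb{Z}^n$ is the abelianization, on which $\mathrm{Out}(A_\Gamma)$ acts. $\mathcal{I}(A_\Gamma)\leq \mathrm{Out}(A_\Gamma)$ (the Torelli subgroup) is the subgroup of outer automorphisms acting trivially on $H_1(A_\Gamma)$. *)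

(* Defs.v *)
From HB Require Import structures.
From mathcomp Require Import all_boot.
From mathcomp Require Import boolp.

Set Implicit Arguments.
Unset Strict Implicit.
Unset Printing Implicit Defensive.

Local Open Scope group_scope.
Local Open Scope quotient_scope.

Section Torsion.
Variable G : groupType.

Definition finite_order (x : G) : Prop := exists2 n : nat, (0 < n)%N & x ^+ n = 1.

Definition torsion_free : Prop := forall x : G, finite_order x -> x = 1.

End Torsion.

Record normal_subgroup (G : groupType) := NormalSubgroup {
  nsub :> {pred G};
  nsub_closed : group_closed nsub;
  nsub_conj : forall x y : G, x \in nsub -> x ^ y \in nsub
}.

Section Quotient.
Variables (G : groupType) (N : normal_subgroup G).
Implicit Types x y z : G.

Lemma nsub1 : 1 \in N. Proof. by case: (nsub_closed N). Qed.

Lemma nsubV x : x \in N -> x^-1 \in N.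
Proof. exact: group_closedV (nsub_closed N) x. Qed.

Lemma nsubM x y : x \in N -> y \in N -> x * y \in N.
Proof. exact: group_closedM (nsub_closed N) x y. Qed.

Definition coset_rel : rel G := fun x y => x^-1 * y \in N.

Lemma coset_rel_refl : reflexive coset_rel.
Proof. by move=> x; rewrite /coset_rel mulVg nsub1. Qed.

Lemma coset_rel_sym : symmetric coset_rel.
Proof.
suff H x y : coset_rel x y -> coset_rel y x by move=> x y; apply/idP/idP => /H.
by rewrite /coset_rel => /nsubV; rewrite invgM invgK.
Qed.

Lemma coset_rel_trans : transitive coset_rel.
Proof.
move=> y x z; rewrite /coset_rel => xy /(nsubM xy).
by rewrite -mulgA mulVKg.
Qed.

Canonical coset_equiv :=
  EquivRel coset_rel coset_rel_refl coset_rel_sym coset_rel_trans.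

Definition quotg : Type := {eq_quot coset_rel}.
HB.instance Definition _ := Choice.on quotg.
HB.instance Definition _ := EqQuotient.on quotg.

Definition quotg_proj : G -> quotg := \pi_quotg.

Lemma quotg_projP x y : quotg_proj x = quotg_proj y <-> x^-1 * y \in N.
Proof. by split=> [/eqmodP|H] //; apply/eqmodP. Qed.

Lemma quotg_projK (a : quotg) : quotg_proj (repr a) = a.
Proof. exact: reprK. Qed.

Definition quotg_one : quotg := quotg_proj 1.
Definition quotg_inv (a : quotg) : quotg := quotg_proj (repr a)^-1.
Definition quotg_mul (a b : quotg) : quotg := quotg_proj (repr a * repr b).

Lemma quotg_mulE x y : quotg_mul (quotg_proj x) (quotg_proj y) = quotg_proj (x * y).
Proof.
rewrite /quotg_mul; apply/quotg_projP.
have /quotg_projP hx := quotg_projK (quotg_proj x).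
have /quotg_projP hy := quotg_projK (quotg_proj y).
have := nsubM (nsub_conj (repr (quotg_proj y)) hx) hy.
by rewrite invgM conjgE !mulgA mulgK.
Qed.

Lemma quotg_invE x : quotg_inv (quotg_proj x) = quotg_proj x^-1.
Proof.
rewrite /quotg_inv; apply/quotg_projP; rewrite invgK.
have /quotg_projP /nsubV := quotg_projK (quotg_proj x).
move=> /(nsub_conj x^-1).
by rewrite invgM invgK conjgE invgK !mulgA mulgV mul1g.
Qed.

Lemma quotg_mulA : associative quotg_mul.
Proof.
move=> a b c; rewrite -[a]quotg_projK -[b]quotg_projK -[c]quotg_projK.
by rewrite !quotg_mulE mulgA.
Qed.

Lemma quotg_mul1g : left_id quotg_one quotg_mul.
Proof. by move=> a; rewrite -[a]quotg_projK quotg_mulE mul1g. Qed.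

Lemma quotg_mulg1 : right_id quotg_one quotg_mul.
Proof. by move=> a; rewrite -[a]quotg_projK quotg_mulE mulg1. Qed.

Lemma quotg_mulVg : left_inverse quotg_one quotg_inv quotg_mul.
Proof. by move=> a; rewrite -[a]quotg_projK quotg_invE quotg_mulE mulVg. Qed.

Lemma quotg_mulgV : right_inverse quotg_one quotg_inv quotg_mul.
Proof. by move=> a; rewrite -[a]quotg_projK quotg_invE quotg_mulE mulgV. Qed.

HB.instance Definition _ := isGroup.Build quotg
  quotg_mulA quotg_mul1g quotg_mulg1 quotg_mulVg quotg_mulgV.

Lemma quotg_projF : {morph quotg_proj : x y / x / y}.
Proof. by move=> x y; rewrite -quotg_mulE -quotg_invE. Qed.

HB.instance Definition _ := isGroupMorphism.Build G quotg quotg_proj quotg_projF.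

End Quotient.

Section Presentation.
Variables (X : choiceType) (R : seq (X * bool) -> Prop).

(* In a word, the letter (x, true) stands for x and (x, false) for x^-1. *)
Local Notation word := (seq (X * bool)).

(* The congruence on words generated by the free cancellations and r = 1,
   for r in R. *)
Inductive pres_eq : word -> word -> Prop :=
| pres_refl u : pres_eq u u
| pres_sym u v : pres_eq u v -> pres_eq v u
| pres_trans u v w : pres_eq u v -> pres_eq v w -> pres_eq u w
| pres_cat u u' v v' : pres_eq u u' -> pres_eq v v' -> pres_eq (u ++ v) (u' ++ v')
| pres_cancel x b : pres_eq [:: (x, b); (x, ~~ b)] [::]
| pres_relator r : R r -> pres_eq r [::].

Definition pres_rel : rel word := fun u v => `[< pres_eq u v >].

Lemma pres_rel_refl : reflexive pres_rel.
Proof. by move=> u; apply/asboolP; apply: pres_refl. Qed.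

Lemma pres_rel_sym : symmetric pres_rel.
Proof. by move=> u v; apply: asbool_equiv_eq; split; apply: pres_sym. Qed.

Lemma pres_rel_trans : transitive pres_rel.
Proof. by move=> v u w /asboolP uv /asboolP vw; apply/asboolP; apply: pres_trans vw. Qed.

Canonical pres_equiv := EquivRel pres_rel pres_rel_refl pres_rel_sym pres_rel_trans.

Definition pres_group : Type := {eq_quot pres_rel}.
HB.instance Definition _ := Choice.on pres_group.
HB.instance Definition _ := EqQuotient.on pres_group.

Definition pres_proj : word -> pres_group := \pi_pres_group.

Lemma pres_projP u v : pres_proj u = pres_proj v <-> pres_eq u v.
Proof. by split=> [/eqmodP /asboolP|H] //; apply/eqmodP/asboolP. Qed.

Lemma pres_projK (a : pres_group) : pres_proj (repr a) = a.
Proof. exact: reprK. Qed.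

Definition word_inv (u : word) : word := rev [seq (l.1, ~~ l.2) | l <- u].

Lemma word_inv_cat u v : word_inv (u ++ v) = word_inv v ++ word_inv u.
Proof. by rewrite /word_inv map_cat rev_cat. Qed.

Lemma word_invK : involutive word_inv.
Proof.
move=> u; rewrite /word_inv map_rev revK -map_comp map_id_in // => -[x b] _ /=.
by rewrite negbK.
Qed.

Lemma pres_mulgV u : pres_eq (u ++ word_inv u) [::].
Proof.
elim: u => [|[x b] u IHu]; first exact: pres_refl.
rewrite -cat1s word_inv_cat -catA [u ++ _]catA.
apply: pres_trans (pres_cancel x b).
by apply: (@pres_cat [:: _] [:: _] _ [:: _] (pres_refl _)) (pres_cat IHu (pres_refl _)).
Qed.

Lemma pres_mulVg u : pres_eq (word_inv u ++ u) [::].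
Proof. by rewrite -{2}[u]word_invK; apply: pres_mulgV. Qed.

Lemma pres_inv u v : pres_eq u v -> pres_eq (word_inv u) (word_inv v).
Proof.
move=> uv; have h1 := pres_cat (pres_refl (word_inv u)) (pres_mulgV v).
have h2 := pres_cat (pres_mulVg u) (pres_refl (word_inv v)).
rewrite cats0 in h1; apply: pres_trans (pres_sym h1) _.
apply: pres_trans h2; rewrite -catA.
by apply: pres_cat (pres_refl _) (pres_cat (pres_sym uv) (pres_refl _)).
Qed.

Definition pres_one : pres_group := pres_proj [::].
Definition pres_invg (a : pres_group) : pres_group := pres_proj (word_inv (repr a)).
Definition pres_mul (a b : pres_group) : pres_group := pres_proj (repr a ++ repr b).

Lemma pres_mulE u v : pres_mul (pres_proj u) (pres_proj v) = pres_proj (u ++ v).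
Proof. by apply/pres_projP/pres_cat; apply/pres_projP/pres_projK. Qed.

Lemma pres_invE u : pres_invg (pres_proj u) = pres_proj (word_inv u).
Proof. by apply/pres_projP/pres_inv; apply/pres_projP/pres_projK. Qed.

Lemma pres_mulA_subproof : associative pres_mul.
Proof.
move=> a b c; rewrite -[a]pres_projK -[b]pres_projK -[c]pres_projK.
by rewrite !pres_mulE catA.
Qed.

Lemma pres_mul1g_subproof : left_id pres_one pres_mul.
Proof. by move=> a; rewrite -[a]pres_projK pres_mulE. Qed.

Lemma pres_mulg1_subproof : right_id pres_one pres_mul.
Proof. by move=> a; rewrite -[a]pres_projK pres_mulE cats0. Qed.

Lemma pres_mulVg_subproof : left_inverse pres_one pres_invg pres_mul.
Proof.
move=> a; rewrite -[a]pres_projK pres_invE pres_mulE.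
exact/pres_projP/pres_mulVg.
Qed.

Lemma pres_mulgV_subproof : right_inverse pres_one pres_invg pres_mul.
Proof.
move=> a; rewrite -[a]pres_projK pres_invE pres_mulE.
exact/pres_projP/pres_mulgV.
Qed.

HB.instance Definition _ := isGroup.Build pres_group
  pres_mulA_subproof pres_mul1g_subproof pres_mulg1_subproof
  pres_mulVg_subproof pres_mulgV_subproof.

Definition pres_gen (x : X) : pres_group := pres_proj [:: (x, true)].

Lemma pres_projM u v : pres_proj (u ++ v) = pres_proj u * pres_proj v.
Proof. by rewrite -pres_mulE. Qed.

Lemma pres_projV u : pres_proj (word_inv u) = (pres_proj u)^-1.
Proof. by rewrite -pres_invE. Qed.

End Presentation.

Record sgraph := SGraph {
  vertex :> finType;
  adj : rel vertex;
  adj_sym : symmetric adj;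
  adj_irr : irreflexive adj
}.

Section RAAG.
Variable Gamma : sgraph.

Definition comm_word (v w : Gamma) : seq (Gamma * bool) :=
  [:: (v, false); (w, false); (v, true); (w, true)].

Definition raag_relator (r : seq (Gamma * bool)) : Prop :=
  exists v w : Gamma, adj v w /\ r = comm_word v w.

Definition raag : groupType := pres_group raag_relator.

Definition raag_gen (v : Gamma) : raag := pres_gen raag_relator v.

Lemma raag_gen_comm (v w : Gamma) : adj v w -> [~ raag_gen v, raag_gen w] = 1.
Proof.
move=> vw; have rel : pres_eq raag_relator (comm_word v w) [::].
  by apply: pres_relator; exists v, w.
transitivity (pres_proj raag_relator (comm_word v w)); last exact/pres_projP.
set a := [:: (v, true)]; set b := [:: (w, true)].
rewrite -[comm_word v w]/(word_inv a ++ (word_inv b ++ (a ++ b))).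
by rewrite !pres_projM !pres_projV.
Qed.

End RAAG.

Section Aut.
Variable G : groupType.

Definition is_aut : {pred G -> G} :=
  fun f => `[< {morph f : x y / x * y} /\ bijective f >].

Record Aut := MkAut { aut_val :> G -> G; autP : aut_val \in is_aut }.

HB.instance Definition _ := [isSub for aut_val].
HB.instance Definition _ := [Choice of Aut by <:].

Implicit Types f g : Aut.

Lemma autM f : {morph f : x y / x * y}.
Proof. by have /asboolP[] := autP f. Qed.

Lemma aut_bij f : bijective f.
Proof. by have /asboolP[] := autP f. Qed.

Lemma aut_ext f g : f =1 g -> f = g.
Proof. by move=> fg; apply: val_inj; apply: funext. Qed.

Lemma autF f : {morph f : x y / x / y}.
Proof. by move=> x y; apply: (canRL (mulgK _)); rewrite -autM mulgVK. Qed.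

HB.instance Definition _ f := isGroupMorphism.Build G G f (autF f).

Lemma aut_one_subproof : idfun \in is_aut.
Proof. by apply/asboolP; split=> //; exists idfun. Qed.

Definition aut_one : Aut := MkAut aut_one_subproof.

Lemma aut_mul_subproof f g : f \o g \in is_aut.
Proof.
apply/asboolP; split; last exact: bij_comp (aut_bij f) (aut_bij g).
by move=> x y /=; rewrite !autM.
Qed.

Definition aut_mul f g : Aut := MkAut (aut_mul_subproof f g).

Lemma aut_inv_subproof f : exists g : Aut, cancel g f /\ cancel f g.
Proof.
have [g fK gK] := aut_bij f.
suff gA : g \in is_aut by exists (MkAut gA).
apply/asboolP; split; last by exists f.
by move=> x y; apply: (bij_inj (aut_bij f)); rewrite autM !gK.
Qed.

Definition aut_inv f : Aut := projT1 (cid (aut_inv_subproof f)).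

Lemma aut_invK f : cancel (aut_inv f) f.
Proof. by rewrite /aut_inv; case: cid => g []. Qed.

Lemma autK f : cancel f (aut_inv f).
Proof. by rewrite /aut_inv; case: cid => g []. Qed.

Lemma aut_mulA : associative aut_mul.
Proof. by move=> f g h; apply: aut_ext. Qed.

Lemma aut_mul1g : left_id aut_one aut_mul.
Proof. by move=> f; apply: aut_ext. Qed.

Lemma aut_mulg1 : right_id aut_one aut_mul.
Proof. by move=> f; apply: aut_ext. Qed.

Lemma aut_mulVg : left_inverse aut_one aut_inv aut_mul.
Proof. by move=> f; apply: aut_ext => x /=; rewrite autK. Qed.

Lemma aut_mulgV : right_inverse aut_one aut_inv aut_mul.
Proof. by move=> f; apply: aut_ext => x /=; rewrite aut_invK. Qed.

HB.instance Definition _ := isGroup.Build Aut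
  aut_mulA aut_mul1g aut_mulg1 aut_mulVg aut_mulgV.

Lemma aut1E x : (1 : Aut) x = x. Proof. by []. Qed.
Lemma autME f g x : (f * g) x = f (g x). Proof. by []. Qed.
Lemma autVK f : cancel f^-1 f. Proof. exact: aut_invK. Qed.
Lemma autKV f : cancel f f^-1. Proof. exact: autK. Qed.

Definition is_inner : {pred Aut} :=
  fun f => `[< exists c : G, forall x, f x = x ^ c >].

Lemma is_inner_closed : group_closed is_inner.
Proof.
split; first by apply/asboolP; exists 1 => x; rewrite conjg1.
move=> f g /asboolP[c fc] /asboolP[d gd]; apply/asboolP.
exists (d^-1 * c) => x; rewrite autME fc conjgM; congr (_ ^ c).
by apply: (bij_inj (aut_bij g)); rewrite aut_invK gd conjgKV.
Qed.

Lemma is_inner_conj f g : f \in is_inner -> f ^ g \in is_inner.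
Proof.
move=> /asboolP[c fc]; apply/asboolP; exists (g^-1 c) => x.
by rewrite /conjg !autME fc /conjg !autM gmulfV autK.
Qed.

Definition Inn : normal_subgroup Aut := NormalSubgroup is_inner_closed is_inner_conj.

Definition Out : groupType := quotg Inn.

End Aut.

Section Abelianization.
Variable G : groupType.

Definition derived_pred : {pred G} := fun x =>
  `[< forall S : {pred G}, group_closed S ->
        (forall a b : G, [~ a, b] \in S) -> x \in S >].

Lemma derived_closed : group_closed derived_pred.
Proof.
split; first by apply/asboolP => S [].
move=> x y /asboolP xD /asboolP yD; apply/asboolP => S Sg Sc.
by case: (Sg) => _; apply; [apply: xD | apply: yD].
Qed.

Lemma derived_comm a b : [~ a, b] \in derived_pred.
Proof. by apply/asboolP => S _; apply. Qed.

Lemma derived_conj x y : x \in derived_pred -> x ^ y \in derived_pred.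
Proof.
move=> xD; rewrite -[x ^ y](mulVKg x) -commgEl.
exact: group_closedM derived_closed _ _ xD (derived_comm x y).
Qed.

Definition derived : normal_subgroup G := NormalSubgroup derived_closed derived_conj.

(* The first homology group, written multiplicatively. *)
Definition H1 : groupType := quotg derived.

Definition H1_proj : G -> H1 := @quotg_proj G derived.
HB.instance Definition _ := Multiplicative.on H1_proj.
HB.instance Definition _ := UMagmaMorphism.on H1_proj.

Lemma H1_projP (a : H1) : exists x, a = H1_proj x.
Proof. by exists (repr a); rewrite /H1_proj quotg_projK. Qed.

Lemma H1_comm (a b : H1) : commute a b.
Proof.
apply/commgP/eqP; rewrite -[a]quotg_projK -[b]quotg_projK -gmulfR.
apply/esym/quotg_projP; rewrite invg1 mul1g; exact: derived_comm.
Qed.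

End Abelianization.

Section Action.
Variable G : groupType.
Implicit Types (f g : Aut G) (phi psi : Out G).

Lemma aut_derived f x : x \in derived G -> f x \in derived G.
Proof.
move=> /asboolP xD; apply: (xD [pred z | f z \in derived G]) => [|a b].
  split; first by rewrite inE gmulf1 nsub1.
  by move=> u v; rewrite !inE gmulfF => uD vD; apply: (nsub_closed (derived G)).2.
by rewrite inE gmulfR; apply: derived_comm.
Qed.

Definition H1_map f (a : H1 G) : H1 G := H1_proj (f (repr a)).

Lemma H1_mapE f x : H1_map f (H1_proj x) = H1_proj (f x).
Proof.
apply/quotg_projP; rewrite -gmulfV -gmulfM; apply: aut_derived.
exact/quotg_projP/quotg_projK.
Qed.

Lemma H1_map_aut f : H1_map f \in @is_aut (H1 G).
Proof.
apply/asboolP; split.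
  move=> a b; have [x ->] := H1_projP a; have [y ->] := H1_projP b.
  by rewrite -gmulfM !H1_mapE !gmulfM.
by exists (H1_map f^-1) => a; have [x ->] := H1_projP a;
  rewrite !H1_mapE ?autKV ?autVK.
Qed.

Definition aut_H1 f : Aut (H1 G) := MkAut (H1_map_aut f).

Lemma aut_H1E f x : aut_H1 f (H1_proj x) = H1_proj (f x).
Proof. exact: H1_mapE. Qed.

Lemma aut_H1F : {morph aut_H1 : f g / f / g}.
Proof.
move=> f g; apply: (canRL (mulgK _)); apply: aut_ext => a.
by have [x ->] := H1_projP a; rewrite autME !aut_H1E autME autKV.
Qed.

HB.instance Definition _ := isGroupMorphism.Build _ _ aut_H1 aut_H1F.

Lemma aut_H1_inner f : f \in Inn G -> aut_H1 f = 1.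
Proof.
move=> /asboolP[c fc]; apply: aut_ext => a; have [x ->] := H1_projP a.
by rewrite aut_H1E fc gmulfJ; apply/conjg_fixP/commgP/H1_comm.
Qed.

(* The action of Out G on the first homology; see out_H1E for the
   independence of the representative. *)
Definition out_H1 phi : Aut (H1 G) := aut_H1 (repr phi).

Lemma out_H1E f : out_H1 (quotg_proj (Inn G) f) = aut_H1 f.
Proof.
have /quotg_projP/aut_H1_inner := quotg_projK (quotg_proj (Inn G) f).
by rewrite gmulfM gmulfV => /eqP; rewrite mulg_eq1 => /eqP/invg_inj.
Qed.

Lemma out_H1F : {morph out_H1 : phi psi / phi / psi}.
Proof.
move=> phi psi; rewrite -[phi]quotg_projK -[psi]quotg_projK.
by rewrite -gmulfF !out_H1E gmulfF.
Qed.

HB.instance Definition _ := isGroupMorphism.Build _ _ out_H1 out_H1F.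

Definition acts_trivially phi : Prop := forall a : H1 G, out_H1 phi a = a.

Definition torelli_pred : {pred Out G} := fun phi => `[< acts_trivially phi >].

Lemma torelli_closed : group_closed torelli_pred.
Proof.
have tE phi : phi \in torelli_pred -> out_H1 phi = 1.
  by move=> /asboolP H; apply: aut_ext.
split; first by apply/asboolP => a; rewrite gmulf1.
by move=> phi psi /tE h1 /tE h2; apply/asboolP => a; rewrite out_H1F h1 h2 divgg.
Qed.

Record Torelli := MkTorelli { torelli_val : Out G; torelliP : torelli_val \in torelli_pred }.

HB.instance Definition _ := [isSub for torelli_val].
HB.instance Definition _ := [Choice of Torelli by <:].
HB.instance Definition _ :=
  SubChoice_isSubGroup.Build (Out G) torelli_pred Torelli torelli_closed.

End Action.

(* Main.v *)
(** Let phi act trivially on H_1 and let phi^n be conjugation by c.  Composing a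
    polynomial function F on the group (one whose linear extension to the group
    ring kills a power of the augmentation ideal) with phi changes it by a
    function of lower degree, so j |-> F (phi^j g) is a polynomial in j; its
    values at the multiples of n are the F (c^-i g c^i).  Hence if F is constant
    on those conjugates of g, then F (phi g) = F g.

    The functions F are linear combinations of coefficients of the Magnus
    expansion v |-> 1 + v in power series in partially commuting variables.
    Summing over the cyclically reduced words of a given length yields class
    functions, which show that phi maps each generator to a conjugate of itself.
    Then generators are fixed one at a time, up to inner automorphisms: if phi
    fixes every v in L and phi w = w^g, then c commutes with L, hence lies in the
    subgroup <S> generated by the vertices S adjacent or equal to every v in L.
    Take g shortest in its double coset <St w> g <S>.  If g <> 1, then g^-1 w g
    is reduced as written and has at least two letters outside S, whereas the
    elements c^-i w c^i involve at most one; a suitable F contradicts this.  So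
    phi w = w^r for some r commuting with L. *)

Require Import Defs.
From mathcomp Require Import all_boot.
From mathcomp Require Import ssralg ssrnum ssrint zify ring boolp.

Set Implicit Arguments.
Unset Strict Implicit.
Unset Printing Implicit Defensive.

Import GRing.Theory.

Local Open Scope group_scope.

(** * Inner automorphisms and their classes in [Out] *)

Section InnerAut.
Variable G : groupType.

Lemma conjg_is_aut (c : G) : (conjg^~ c) \in @is_aut G.
Proof.
apply/asboolP; split; first by move=> x y /=; rewrite conjMg.
by exists (conjg^~ c^-1) => x; rewrite ?conjgK ?conjgKV.
Qed.

Definition inner_aut (c : G) : Aut G := MkAut (conjg_is_aut c).

Lemma inner_aut_inner c : inner_aut c \in Inn G.
Proof. by apply/asboolP; exists c. Qed.

Lemma quotg_proj_inner (phi : Aut G) : quotg_proj (Inn G) phi = 1 <-> phi \in Inn G.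
Proof.
rewrite -[1]/(quotg_proj (Inn G) 1); split=> [/esym/quotg_projP|phiI].
  by rewrite invg1 mul1g.
by apply/esym/quotg_projP; rewrite invg1 mul1g.
Qed.

End InnerAut.

(** * Polynomial functions *)

Section NatPolynomial.
Local Open Scope ring_scope.
Implicit Types h : nat -> int.

(** Integer-valued polynomials of degree less than [N], described by the vanishing of the [N]-th
    finite difference. *)
Fixpoint nat_poly N h : Prop :=
  if N is N'.+1 then nat_poly N' (fun j => h j.+1 - h j) else forall j, h j = 0.

Lemma nat_polyD N h h' : nat_poly N h -> nat_poly N h' ->
  nat_poly N (fun j => h j + h' j).
Proof.
elim: N h h' => [|N IHN] h h' /= hP h'P; first by move=> j; rewrite hP h'P.
have -> : (fun j => h j.+1 + h' j.+1 - (h j + h' j)) =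
          (fun j => (h j.+1 - h j) + (h' j.+1 - h' j)) by apply: funext => j; ring.
exact: IHN.
Qed.

Lemma nat_poly_shift N h k : nat_poly N h -> nat_poly N (fun j => h (j + k)%N).
Proof.
elim: N h => [|N IHN] h /= hP; first by move=> j; rewrite hP.
exact: (IHN (fun j => h j.+1 - h j)).
Qed.

(** The increment over [n] steps is a sum of [n] shifts of the first difference. *)
Lemma nat_poly_diff N h n : nat_poly N.+1 h ->
  nat_poly N (fun j => h (j + n)%N - h j).
Proof.
move=> hP; elim: n => [|n IHn].
  have -> : (fun j => h (j + 0)%N - h j) = (fun=> 0).
    by apply: funext => j; rewrite addn0 subrr.
  elim: (N) => //= k IHk; rewrite subrr; exact: IHk.
have := nat_polyD (nat_poly_shift n (hP : nat_poly N _)) IHn.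
by congr nat_poly; apply: funext => j; rewrite addnS; ring.
Qed.

(* By induction the differences [h (j + n) - h j] vanish, so [h] is [n]-periodic;
   by induction again its slope is constant, and periodicity makes it zero. *)
Lemma nat_poly_const N h n : (0 < n)%N -> nat_poly N h ->
  (forall i, h (i * n)%N = h 0%N) -> forall j, h j = h 0%N.
Proof.
move=> n_gt0; elim: N h => [|N IHN] h hP hn j; first by rewrite !hP.
have per k : h (k + n)%N = h k.
  have dn0 i : h (i * n + n)%N - h (i * n)%N = 0.
    by rewrite -mulSnr !hn subrr.
  apply/eqP; rewrite -subr_eq0.
  rewrite (IHN (fun k => h (k + n)%N - h k) (nat_poly_diff n hP)) /=.
    by rewrite (dn0 0%N).
  by move=> i; rewrite dn0 (dn0 0%N).
have perM k i : h (k + i * n)%N = h k.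
  by elim: i => [|i IHi]; rewrite ?mul0n ?addn0 // mulSnr addnA per.
have slope k : h k.+1 - h k = h 1%N - h 0%N.
  apply: (IHN (fun k => h k.+1 - h k)) => // i.
  by rewrite -addn1 addnC (perM 1%N) -[(i * n)%N]add0n perM.
have lin k : h k = h 0%N + (h 1%N - h 0%N) * k%:Z.
  elim: k => [|k IHk]; first by rewrite mulr0 addr0.
  by rewrite -(subrK (h k) (h k.+1)) slope {}IHk; lia.
have := lin n; rewrite -[n in h n]add0n per => /eqP.
rewrite -subr_eq0 opprD addrA subrr add0r oppr_eq0 mulf_eq0.
case/orP=> [/eqP d0|]; last by rewrite eqz_nat; case: (n) n_gt0.
by rewrite lin d0 mul0r addr0.
Qed.

End NatPolynomial.

Section GroupPolynomial.
Variable G : groupType.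
Implicit Types (F : G -> int) (g d x : G) (phi : Aut G).

(* [gpoly k] consists of the functions whose linear extension to the integral
   group ring vanishes on the [k]-th power of the augmentation ideal. *)
Fixpoint gpoly k F : Prop :=
  if k is k'.+1 then forall g, gpoly k' (fun x => F (g * x)%g - F x)%R
  else forall x, F x = 0%R.

Lemma gpolyB k F F' : gpoly k F -> gpoly k F' -> gpoly k (fun x => F x - F' x)%R.
Proof.
elim: k F F' => [|k IHk] F F' FP F'P; first by move=> x; rewrite FP F'P.
move=> g; have := IHk _ _ (FP g) (F'P g).
by congr gpoly; apply: funext => x; ring.
Qed.

Lemma gpoly0 k : gpoly k (fun=> 0%R).
Proof. by elim: k => //= k IHk g; rewrite subrr. Qed.

Lemma gpolyD k F F' : gpoly k F -> gpoly k F' -> gpoly k (fun x => F x + F' x)%R.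
Proof.
move=> FP /(gpolyB (gpoly0 k)) /(gpolyB FP).
by congr gpoly; apply: funext => x; ring.
Qed.

(** Differencing the translate along [g] amounts to translating the difference along
    [d * g * d^-1]. *)
Lemma gpoly_transl k F d : gpoly k F -> gpoly k (fun x => F (d * x)).
Proof.
elim: k F => [|k IHk] F FP; first by move=> x; apply: FP.
move=> g; have := IHk _ (FP (d * g * d^-1)).
by congr gpoly; apply: funext => x; rewrite !mulgA mulgVK.
Qed.

Lemma gpoly_aut k F phi : gpoly k F -> gpoly k (fun x => F (phi x)).
Proof.
elim: k F => [|k IHk] F FP; first by move=> x; apply: FP.
move=> g; have := IHk _ (FP (phi g)).
by congr gpoly; apply: funext => x; rewrite autM.
Qed.

(** This is dual to the fact that [d - 1] lies in the square of the augmentation ideal. *)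
Lemma gpoly_derived k F d : d \in derived G -> gpoly k.+2 F ->
  gpoly k (fun x => F (d * x)%g - F x)%R.
Proof.
pose S : {pred G} := fun d => `[< forall k F, gpoly k.+2 F ->
  gpoly k (fun x => F (d * x)%g - F x)%R >].
move=> /asboolP dD; suff /asboolP : d \in S by apply.
apply: dD => [|a b].
  split.
    apply/asboolP => {}k {}F _; have := gpoly0 k.
    by congr gpoly; apply: funext => x; rewrite mul1g subrr.
  move=> a b /asboolP aP /asboolP bP; apply/asboolP => {}k {}F FP.
  have := gpolyB (gpoly_transl b^-1 (aP _ _ FP)) (gpoly_transl b^-1 (bP _ _ FP)).
  by congr gpoly; apply: funext => x; rewrite mulVKg -mulgA; ring.
apply/asboolP => {}k {}F FP.
(* The two mixed second differences along [a^-1] and [b^-1] differ by [F (a^-1 * b^-1 * x) - F (b^-1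
   * a^-1 * x)]; substituting [a * b * x] for [x] produces the commutator. *)
have := gpoly_transl (a * b) (gpolyB (FP a^-1 b^-1) (FP b^-1 a^-1)).
congr gpoly; apply: funext => x.
by rewrite /commg /conjg -!mulgA !mulKg; ring.
Qed.

Lemma gpoly_torelli k F phi : (forall x, x^-1 * phi x \in derived G) ->
  gpoly k.+1 F -> gpoly k (fun x => F (phi x) - F x)%R.
Proof.
move=> phiD; elim: k F => [|k IHk] F FP.
  move=> x; have H y : F y = F 1 by rewrite -[y]mulg1 -[LHS](subrK (F 1)) (FP y 1) add0r.
  by rewrite (H (phi x)) (H x) subrr.
(* With [d = g^-1 * phi g] and [Fg x = F (g * x) - F x], the difference along [g] is
   [Fg (phi x) - Fg x] plus [F (g * d * phi x) - F (g * phi x)]. *)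
move=> g; have := gpolyD (IHk _ (FP g))
  (gpoly_aut phi (gpoly_derived (phiD g) (gpoly_transl g FP))).
by congr gpoly; apply: funext => x; rewrite mulgA mulVKg autM; ring.
Qed.

Lemma orbit_nat_poly k F phi x : (forall x, x^-1 * phi x \in derived G) ->
  gpoly k F -> nat_poly k (fun j => F ((phi ^+ j) x)).
Proof.
move=> phiD; elim: k F => [|k IHk] F FP /=; first by move=> j; apply: FP.
have := IHk _ (gpoly_torelli phiD FP).
by congr nat_poly; apply: funext => j; rewrite expgS autME.
Qed.

Lemma gpoly_fixed k F phi n c x : (0 < n)%N ->
  (forall x, x^-1 * phi x \in derived G) -> (forall x, (phi ^+ n) x = x ^ c) ->
  gpoly k F -> (forall i, F (x ^ (c ^+ i)) = F x) -> F (phi x) = F x.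
Proof.
move=> n_gt0 phiD phin FP Fc.
have powc i : (phi ^+ (i * n)) x = x ^ (c ^+ i).
  elim: i => [|i IHi]; first by rewrite mul0n conjg1.
  by rewrite mulSn expgnDr autME IHi phin -conjgM -expgSr.
have := nat_poly_const n_gt0 (orbit_nat_poly x phiD FP) _ 1%N.
by rewrite expg1 expg0 aut1E; apply => i; rewrite powc Fc.
Qed.

End GroupPolynomial.

(** * Magnus coefficients *)

Section Magnus.
Variable Gamma : sgraph.
Local Open Scope ring_scope.
Local Notation G := (raag Gamma).
Local Notation gen := (@raag_gen Gamma).
Local Notation proj := (pres_proj (@raag_relator Gamma)).
Implicit Types (f h : seq Gamma -> int) (nu alpha beta : seq Gamma) (x y z : Gamma).
Implicit Types (w : seq (Gamma * bool)) (g : G).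

Variable m : nat.

(* With [f] read as a linear functional on power series in partially commuting
   variables, killing the words longer than [m], [act_letter (x, b) f] is
   [f] precomposed with right multiplication by [(1 + x)^(+-1)]; the fuel in
   [inv_fuel] truncates the series of [(1 + x)^-1]. *)
Fixpoint inv_fuel k x f nu : int :=
  if k is k'.+1 then f nu - inv_fuel k' x f (rcons nu x) else 0.

Definition act_letter (l : Gamma * bool) f nu : int :=
  if l.2 then f nu + f (rcons nu l.1) else inv_fuel m.+1 l.1 f nu.

Definition act_word w f := foldr act_letter f w.

Definition truncated f := forall nu, (m < size nu)%N -> f nu = 0.

(** This invariance lets a function on ordinary words stand for a functional on monomials in
    partially commuting variables. *)
Definition swap_inv f := forall alpha beta x y, adj x y ->
  f (alpha ++ x :: y :: beta) = f (alpha ++ y :: x :: beta).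

Definition functional f := truncated f /\ swap_inv f.

Definition linear_closed (P : (seq Gamma -> int) -> Prop) :=
  P (fun=> 0) /\ forall f h, P f -> P h -> P (fun nu => f nu - h nu).

Lemma act_letter_closed P l f : linear_closed P ->
  (forall h, P h -> P (fun nu => h (rcons nu l.1))) -> P f -> P (act_letter l f).
Proof.
move=> [P0 PB] Px fP; rewrite /act_letter; case: l.2.
  have := PB _ _ fP (PB _ _ P0 (Px _ fP)).
  by congr P; apply: funext => nu; ring.
elim: m.+1 => [|k IHk]; first exact: P0.
exact: PB fP (Px _ IHk).
Qed.

(** One induction for all properties preserved by the action: being a functional, being square-free,
    vanishing on words with few letters outside a set. The last one needs shifts restricted to
    letters of [w]. *)
Lemma act_word_closed P w f : linear_closed P ->
  (forall x h, x \in map fst w -> P h -> P (fun nu => h (rcons nu x))) ->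
  P f -> P (act_word w f).
Proof.
move=> Plin; elim: w => //= l w IHw Px fP; apply: act_letter_closed => //.
  by move=> h; apply: Px; rewrite mem_head.
by apply: IHw => // x h xw; apply: Px; rewrite inE xw orbT.
Qed.

Lemma functional_linear : linear_closed functional.
Proof.
split; first by split.
move=> f h [ft fs] [ht hs]; split; first by move=> nu ?; rewrite ft ?ht.
by move=> alpha beta x y xy; rewrite (fs _ _ _ _ xy) (hs _ _ _ _ xy).
Qed.

Lemma functional_shift x f : functional f -> functional (fun nu => f (rcons nu x)).
Proof.
move=> [ft fs]; split; first by move=> nu ?; rewrite ft // size_rcons ltnW.
by move=> alpha beta y z yz; rewrite !rcons_cat /= fs.
Qed.

Lemma act_word_functional w f : functional f -> functional (act_word w f).
Proof.
by apply: act_word_closed functional_linear _ => x h _; apply: functional_shift.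
Qed.

(** The extra term evaluates [f] on a word longer than [m]. *)
Lemma inv_fuelS k x f nu : truncated f -> (m < size nu + k)%N ->
  inv_fuel k.+1 x f nu = inv_fuel k x f nu.
Proof.
move=> ft; elim: k nu => [|k IHk] nu nuk /=; first by rewrite ft ?subr0 // -[size _]addn0.
by congr (_ - _); apply: IHk; rewrite size_rcons addSnnS.
Qed.

Lemma act_letterK x b f : functional f ->
  act_letter (x, b) (act_letter (x, ~~ b) f) = f.
Proof.
move=> [ft _]; apply: funext => nu; rewrite /act_letter; case: b => /=.
  (* Unfolding spends one unit of fuel, which is harmless at the longer word [rcons nu x]. *)
  rewrite -/(inv_fuel m.+1 x f (rcons nu x)) inv_fuelS ?size_rcons
    ?addSn ?ltnS ?leq_addl //.
  by rewrite subrK.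
suff H k mu : (m < size mu + k)%N ->
    inv_fuel k x (fun nu => f nu + f (rcons nu x)) mu = f mu.
  by apply: (H m.+1); rewrite leq_addl.
elim: k mu => [|k IHk] mu /= muk; first by rewrite ft // -[size _]addn0.
by rewrite IHk ?addrK // size_rcons addSnnS.
Qed.

Lemma act_word_cat u w f : act_word (u ++ w) f = act_word u (act_word w f).
Proof. exact: foldr_cat. Qed.

Lemma act_word_pres u w : pres_eq (@raag_relator Gamma) u w ->
  forall f, functional f -> act_word u f = act_word w f.
Proof.
elim=> {u w} [u|u v _ IH|u v w _ IH1 _ IH2|u u' v v' _ IHu _ IHv|x b
  |r [v [w [vw ->]]]] // f ff.
- by rewrite IH.
- by rewrite IH1 ?IH2.
- by rewrite !act_word_cat IHv // IHu //; apply: act_word_functional.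
- exact: act_letterK.
rewrite /act_word /=; set h := act_letter (v, true) _.
(* The factors [1 + v] and [1 + w] commute on [f]; once they are exchanged, the letters of the
   relator cancel in pairs. *)
suff -> : h = act_letter (w, true) (act_letter (v, true) f).
  rewrite (act_letterK w false); last exact: (act_word_functional [:: (v, true)]).
  exact: (act_letterK v false).
case: (ff) => _ fs; apply: funext => nu; rewrite /h /act_letter /= -!cats1 -!catA /=.
by rewrite (fs nu [::] _ _ vw); ring.
Qed.

Definition act (g : G) f := act_word (repr g) f.

Lemma act_proj w f : functional f -> act (proj w) f = act_word w f.
Proof. by apply: act_word_pres; apply/pres_projP/pres_projK. Qed.

Lemma actM g g' f : functional f -> act (g * g')%g f = act g (act g' f).
Proof.
move=> ff; rewrite -[g in LHS]pres_projK -[g' in LHS]pres_projK -pres_projM.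
by rewrite act_proj // act_word_cat.
Qed.

Lemma act1 f : functional f -> act 1%g f = f.
Proof. by move=> ff; rewrite (act_proj [::]). Qed.

Lemma act_functional g f : functional f -> functional (act g f).
Proof. exact: act_word_functional. Qed.

Lemma act_gen x f nu : functional f -> act (gen x) f nu = f nu + f (rcons nu x).
Proof. by move=> ff; rewrite (act_proj [:: (x, true)]). Qed.

Lemma gen_subgroup_ind (S : G -> Prop) : S 1%g ->
  (forall g g', S g -> S g' -> S (g * g')%g) -> (forall g, S g -> S g^-1%g) ->
  (forall x, S (gen x)) -> forall g, S g.
Proof.
move=> S1 SM SV Sgen g; rewrite -[g]pres_projK; elim: (repr g) => // -[x b] w IHw.
rewrite -cat1s pres_projM; apply: SM => //; case: b; first exact: Sgen.
by rewrite -[[:: _]]/(word_inv [:: (x, true)]) pres_projV; apply/SV/Sgen.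
Qed.

(** The difference along a generator [x] is the value at the longer word [rcons nu x], and values at
    words longer than [m] vanish. Differences along products and inverses are combinations of
    translates of these. *)
Lemma act_gpoly f nu k : functional f -> (m < size nu + k)%N ->
  gpoly k (fun g => act g f nu).
Proof.
move=> ff; elim: k nu => [|k IHk] nu nuk.
  by move=> g; case: (act_functional g ff) => -> //; rewrite -[size _]addn0.
move=> g; pattern g; apply: gen_subgroup_ind g => [|g g' IHg IHg'|g IHg|x].
- by have := gpoly0 G k; congr gpoly; apply: funext => g; rewrite mul1g subrr.
- have := gpolyD (gpoly_transl g' IHg) IHg'.
  by congr gpoly; apply: funext => y; rewrite mulgA; ring.
- have := gpolyB (gpoly0 G k) (gpoly_transl g^-1%g IHg).
  by congr gpoly; apply: funext => y; rewrite mulVKg; ring.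
have := IHk (rcons nu x); rewrite size_rcons addSnnS => /(_ nuk).
congr gpoly; apply: funext => g; rewrite actM // act_gen; last exact: act_functional.
by ring.
Qed.

(** The action only appends letters on the right, so a fixed prefix is inert. *)
Lemma act_prefix g f alpha :
  act g (fun nu => f (alpha ++ nu)) = fun nu => act g f (alpha ++ nu).
Proof.
rewrite /act; elim: (repr g) => //= -[x b] w ->; apply: funext => nu.
rewrite /act_letter; case: b => /=; first by rewrite rcons_cat.
rewrite rcons_cat; congr (_ - _); elim: (m) (rcons nu x) => //= k IHk mu.
by rewrite IHk rcons_cat.
Qed.

Lemma act_class_function f : functional f ->
  (forall alpha beta, f (alpha ++ beta) = f (beta ++ alpha)) ->
  forall g g', act (g * g')%g f [::] = act (g' * g)%g f [::].
Proof.
move=> ff frot g; pattern g.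
apply: gen_subgroup_ind g => [g'|g h IHg IHh g'|g IHg g'|x g].
- by rewrite mul1g mulg1.
- by rewrite -mulgA IHg -mulgA IHh mulgA.
- by have := IHg (g^-1 * g' * g^-1)%g; rewrite mulgA mulVKg mulgVK.
(* Rotation invariance moves the appended [x] to the front; by [act_prefix] the second term is then
   the value at [[:: x]], which is what multiplication by [x] on the left contributes. *)
have -> : act (g * gen x)%g f [::] = act g f [::] + act g (fun nu => f (x :: nu)) [::].
  have fx := functional_shift x ff.
  rewrite actM //; have -> : act (gen x) f = fun nu => f nu + f (x :: nu).
    by apply: funext => nu; rewrite act_gen // -cats1 frot.
  have invD k z : forall h h' nu, inv_fuel k z (fun nu => h nu + h' nu) nu =
      inv_fuel k z h nu + inv_fuel k z h' nu.
    by move=> h h'; elim: k => [|k IHk] nu //=; rewrite IHk; ring.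
  have lin w : forall h h', act_word w (fun nu => h nu + h' nu) =
      fun nu => act_word w h nu + act_word w h' nu.
    move=> h h'; elim: w => //= -[y b] w ->; apply: funext => nu.
    by rewrite /act_letter; case: b; rewrite ?invD /=; ring.
  by rewrite /act lin.
rewrite (act_prefix g f [:: x]) actM // act_gen //; exact: act_functional.
Qed.

End Magnus.

(** * Integer powers of group elements *)

Section IntegerPower.
Variable G : groupType.
Implicit Types (x y : G) (k l : int).

Definition zpow x k : G := match k with Posz n => x ^+ n | Negz n => x ^- n.+1 end.

Lemma zpowS x k : zpow x (k + 1)%R = x * zpow x k.
Proof.
case: k => [n|[|n]]; first by rewrite -[(n%:Z + 1)%R]/(Posz (n + 1)) addn1 /= expgS.
  by rewrite /= expg1 mulgV.
have -> : (Negz n.+1 + 1)%R = Negz n by rewrite !NegzE; lia.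
by rewrite /= [x ^+ n.+2]expgSr invgM mulVKg.
Qed.

Lemma zpowD x k l : zpow x (k + l)%R = zpow x k * zpow x l.
Proof.
elim/int_ind: k => [|n IHn|n IHn]; first by rewrite add0r mul1g.
  have -> : (n.+1%:Z + l = n%:Z + l + 1)%R by lia.
  have -> : (n.+1%:Z = n%:Z + 1)%R by lia.
  by rewrite !zpowS IHn mulgA.
apply: (@mulgI _ x); rewrite mulgA -!zpowS.
have -> : (- n.+1%:Z + l + 1 = - n%:Z + l)%R by lia.
by have -> : (- n.+1%:Z + 1 = - n%:Z)%R by lia.
Qed.

Lemma zpowN x k : zpow x (- k)%R = (zpow x k)^-1.
Proof. by apply/(@mulIg _ (zpow x k)); rewrite -zpowD addNr mulVg. Qed.

Lemma commute_zpow x y k : commute x y -> commute x (zpow y k).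
Proof. by move=> xy; case: k => n; [|apply: commuteV]; apply: commuteX. Qed.

End IntegerPower.

(** * Syllable words and their Magnus coefficients *)

Section Syllables.
Variable Gamma : sgraph.
Local Notation G := (raag Gamma).
Local Notation gen := (@raag_gen Gamma).
Local Notation proj := (pres_proj (@raag_relator Gamma)).
Implicit Types (f : seq Gamma -> int) (nu alpha beta : seq Gamma) (x y z : Gamma).
Implicit Types (A : pred Gamma) (g : G) (s : seq (Gamma * int)).

(** Letters are grouped into syllables [(x, k)] because [x^k] acts on square-free functionals as
    [1 + k x]: a syllable costs one degree, whatever its exponent. *)
Definition ev s : G := foldr (fun p g => zpow (gen p.1) p.2 * g) 1 s.

Lemma ev_cat s s' : ev (s ++ s') = ev s * ev s'.
Proof. by elim: s => [|p s IHs] /=; rewrite ?mul1g // IHs mulgA. Qed.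

Definition syl_inv s := rev [seq (p.1, - p.2)%R | p <- s].

Lemma ev_inv s : ev (syl_inv s) = (ev s)^-1.
Proof.
elim: s => [|p s IHs]; first by rewrite invg1.
by rewrite /syl_inv /= rev_cons -cats1 ev_cat /= mulg1 zpowN -/(syl_inv s) IHs invgM.
Qed.

Lemma map_fst_syl_inv s : map fst (syl_inv s) = rev (map fst s).
Proof. by rewrite /syl_inv map_rev -map_comp. Qed.

Lemma adj_commute x y : adj x y -> commute (gen x) (gen y).
Proof. by move=> /raag_gen_comm/eqP/commgP. Qed.

Lemma ev_commute x k s : all (adj x) (map fst s) -> commute (zpow (gen x) k) (ev s).
Proof.
elim: s => [_|p s IHs /= /andP[xp xs]]; first exact: commute1.
apply: commuteM (IHs xs); apply/commute_zpow/commute_sym/commute_zpow.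
exact/commute_sym/adj_commute.
Qed.

Definition lgen A g := exists2 w : seq (Gamma * bool), all A (map fst w) & g = proj w.

Lemma lgen1 A : lgen A 1.
Proof. by exists [::]. Qed.

Lemma lgenM A g (h : G) : lgen A g -> lgen A h -> lgen A (g * h).
Proof.
move=> [w wA ->] [v vA ->]; exists (w ++ v); last by rewrite pres_projM.
by rewrite map_cat all_cat wA.
Qed.

Lemma lgenV A g : lgen A g -> lgen A g^-1.
Proof.
move=> [w wA ->]; exists (word_inv w); last by rewrite pres_projV.
by rewrite /word_inv map_rev all_rev -map_comp.
Qed.

Lemma lgen_zpow A x k : A x -> lgen A (zpow (gen x) k).
Proof.
move=> Ax; have lX n : lgen A (gen x ^+ n).
  elim: n => [|n IHn]; rewrite ?expgS; first exact: lgen1.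
  by apply: lgenM IHn; exists [:: (x, true)] => //=; rewrite Ax.
by case: k => n; [|apply: lgenV]; apply: lX.
Qed.

Lemma lgenT g : lgen predT g.
Proof. by exists (repr g); rewrite ?all_predT // pres_projK. Qed.

Lemma lgen_ev A g : lgen A g -> exists2 s, all A (map fst s) & g = ev s.
Proof.
move=> [w wA ->]; exists [seq (l.1, if l.2 then 1%R else (- 1)%R) | l <- w].
  by rewrite -map_comp.
elim: w {wA} => // -[x b] w IHw; rewrite -cat1s pres_projM IHw /=; congr (_ * _).
case: b => //=; rewrite -[[:: _]]/(word_inv [:: (x, true)]) pres_projV //.
Qed.

Lemma lgen_commute A g (h : G) : (forall x, A x -> commute h (gen x)) ->
  lgen A g -> commute h g.
Proof.
move=> hA [w wA ->]; elim: w wA => [_|[x b] w IHw /= /andP[Ax wA]].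
  exact: commute1.
rewrite -cat1s pres_projM; apply: commuteM (IHw wA).
case: b; first exact: hA.
by rewrite -[[:: _]]/(word_inv [:: (x, true)]) pres_projV; apply/commuteV/hA.
Qed.

Local Open Scope ring_scope.
Variable m : nat.
Local Notation act := (@act Gamma m).
Local Notation functional := (@functional Gamma m).

Definition square_free f := forall alpha beta x, f (alpha ++ x :: x :: beta) = 0.

Lemma act_square_free g f : square_free f -> square_free (act g f).
Proof.
apply: act_word_closed => [|x h _ hP alpha beta y].
  by split=> // {}f h fP hP alpha beta x; rewrite fP hP.
by rewrite rcons_cat hP.
Qed.

Lemma act_zpow x k f nu : functional f -> square_free f ->
  act (zpow (gen x) k) f nu = f nu + k * f (rcons nu x).
Proof.
pose E (k : int) f nu : int := f nu + k * f (rcons nu x).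
have Efun l h : functional h -> functional (E l h).
  move=> hP; have [ht hs] := hP; have [st ss] := functional_shift x hP.
  split=> [mu mum|alpha beta y z yz]; rewrite /E; first by rewrite ht ?st ?mulr0.
  by rewrite (hs _ _ _ _ yz) (ss _ _ _ _ yz).
have Esq l h : square_free h -> square_free (E l h).
  by move=> hP alpha beta y; rewrite /E rcons_cat /= !hP mulr0.
have ED l l' h : square_free h -> E l (E l' h) = E (l + l') h.
  move=> hP; apply: funext => mu; rewrite /E -!cats1 -!catA /= hP; ring.
have E0 h : E 0 h = h by apply: funext => mu; rewrite /E mul0r addr0.
have EX n h : functional h -> square_free h -> act (gen x ^+ n)%g h = E n%:Z h.
  move=> hP hsq; elim: n => [|n IHn]; first by rewrite E0 act1.
  rewrite expgS actM // IHn -[n.+1]addn1 addnC PoszD -ED //.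
  by apply: funext => mu; rewrite act_gen /E ?mul1r //; apply: Efun.
move=> fP fsq; rewrite -/(E k f nu); case: k => n; first by rewrite /= EX.
(* For a negative exponent, [f] is rewritten as [x^(n+1)] acting on [E (- (n+1)) f], and the two
   opposite powers cancel. *)
rewrite /= -{1}[f]E0 -[0](subrr n.+1%:Z) -ED // -EX; [|exact: Efun|exact: Esq].
by rewrite -actM ?mulVg ?act1 //; apply: Efun.
Qed.

Definition homog f := forall nu, size nu != m -> f nu = 0.

(** Each syllable adds at most one letter, so length [m] is out of reach. *)
Lemma act_ev_small s f nu : functional f -> square_free f -> homog f ->
  (size nu + size s < m)%N -> act (ev s) f nu = 0.
Proof.
move=> fP fsq fh; elim: s nu => [|p s IHs] nu /=.
  by rewrite act1 // addn0 => num; rewrite fh // ltn_eqF.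
move=> nus; rewrite actM // act_zpow; last 2 first.
- exact: act_functional.
- exact: act_square_free.
rewrite !IHs ?mulr0 // ?size_rcons ?addSnnS //.
by rewrite (leq_ltn_trans _ nus) // leq_add2l.
Qed.

(** Length [m] is reached only by taking the linear term of every syllable. *)
Lemma act_ev s f nu : functional f -> square_free f -> homog f ->
  (size nu + size s)%N = m ->
  act (ev s) f nu = (\prod_(p <- s) p.2) * f (nu ++ map fst s).
Proof.
move=> fP fsq fh; elim: s nu => [|p s IHs] nu /=.
  by rewrite act1 // big_nil cats0 mul1r.
move=> nus; rewrite actM // act_zpow; last 2 first.
- exact: act_functional.
- exact: act_square_free.
rewrite act_ev_small // ?add0r; last by rewrite -nus ltn_add2l.
by rewrite IHs ?size_rcons ?addSnnS // cat_rcons big_cons mulrA.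
Qed.

Definition few_outside A r f := forall nu, (count (predC A) nu <= r)%N -> f nu = 0.

Lemma act_few_outside A r g f : lgen A g -> functional f ->
  few_outside A r f -> few_outside A r (act g f).
Proof.
move=> [w wA ->] fP; rewrite act_proj //.
apply: act_word_closed => [|x h xw hP nu nur].
  by split=> // f1 f2 f1r f2r nu nur; rewrite f1r ?f2r.
by rewrite hP // -cats1 count_cat /= (allP wA _ xw) !addn0.
Qed.

(** In the expansion of [c^-1 x c] only the middle factor [1 + x] can supply a letter outside [A],
    and it supplies at most one. *)
Lemma act_conj_few_outside A c x f : lgen A c -> functional f ->
  few_outside A 1 f -> act (gen x ^ c)%g f [::] = 0.
Proof.
move=> cA fP f1; have cf := act_functional c fP.
have xcf := act_functional (gen x) cf; rewrite /conjg !actM //.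
apply: (act_few_outside (r := 0) (lgenV cA)) => // nu nu0.
rewrite act_gen //; have {}f1 := act_few_outside cA fP f1.
rewrite f1 ?(leq_trans nu0) // add0r f1 // -cats1 count_cat.
by move: nu0; rewrite leqn0 => /eqP->; rewrite /= addn0; case: (A x).
Qed.

(** [gpoly_fixed] is applied to the value at [h ^ d] as a function of [h]; the conjugator [d] allows
    a shortened conjugate of [phi g] to be tested. *)
Lemma act_fixed (phi : Aut G) n (c d g : G) f : (0 < n)%N ->
  (forall h : G, (h^-1 * phi h)%g \in derived G) ->
  (forall h : G, (phi ^+ n)%g h = (h ^ c)%g) -> functional f ->
  (forall i, act (g ^ (c ^+ i * d))%g f [::] = act (g ^ d)%g f [::]) ->
  act (phi g ^ d)%g f [::] = act (g ^ d)%g f [::].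
Proof.
move=> n_gt0 phiD phin fP fc.
apply: (gpoly_fixed (k := m.+1) (F := fun h => act (h ^ d)%g f [::])) n_gt0 phiD phin _ _.
  have FP : gpoly m.+1 (fun h => act h f [::]) by apply: act_gpoly.
  exact: (gpoly_aut (inner_aut d) FP).
by move=> i; rewrite -conjgM.
Qed.

End Syllables.

(** * Reduced words *)

Section ReducedWords.
Variable Gamma : sgraph.
Local Notation gen := (@raag_gen Gamma).
Implicit Types (nu alpha beta gamma : seq Gamma) (a x y : Gamma) (b : bool).
Implicit Types s : seq (Gamma * int).

(* Reads a word, failing at an [a] whose preceding [a] is separated from it
   only by neighbours of [a]; the flag [b] tells whether the current position is
   so exposed to an earlier [a]. *)
Fixpoint run a b nu : bool :=
  if nu is x :: nu' then
    if x == a then ~~ b && run a true nu' else run a (b && adj a x) nu'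
  else true.

(** The flag of [run] once [nu] has been read. *)
Fixpoint exposed a b nu : bool :=
  if nu is x :: nu' then exposed a ((x == a) || b && adj a x) nu' else b.

(** For the vertices of a syllable word: no two syllables at the same vertex can be brought together
    by commutations. *)
Definition red nu := [forall a, run a false nu].

Lemma run_swap a b alpha beta x y : adj x y ->
  run a b (alpha ++ x :: y :: beta) = run a b (alpha ++ y :: x :: beta).
Proof.
move=> xy; elim: alpha b => [|z alpha IHa] b /=; last by rewrite !IHa.
have [xa|xa] := eqVneq x a; have [ya|ya] := eqVneq y a.
- by rewrite xa ya adj_irr in xy.
- by rewrite -xa xy andbT.
- by rewrite -ya adj_sym xy andbT.
- by rewrite andbAC.
Qed.

Lemma run_mono a b nu : run a true nu -> run a b nu.
Proof.
case: b => //; elim: nu => //= x nu IHnu; case: ifP => // _.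
by case: (adj a x).
Qed.

Lemma run_cat a b alpha beta :
  run a b (alpha ++ beta) = run a b alpha && run a (exposed a b alpha) beta.
Proof.
elim: alpha b => //= x alpha IHa b; rewrite !IHa.
by case: eqP => // _; rewrite andbA.
Qed.

Lemma run_suffix a b alpha beta : run a b (alpha ++ beta) -> run a false beta.
Proof. by rewrite run_cat => /andP[_]; case: exposed => // /run_mono. Qed.

Lemma run_initial a beta gamma : all (adj a) beta ->
  run a true (beta ++ a :: gamma) = false.
Proof.
elim: beta => [_|x beta IHb /= /andP[ax ab]] /=; first by rewrite eqxx.
by rewrite ax IHb // if_same.
Qed.

Lemma run_factor a b alpha beta gamma : all (adj a) beta ->
  run a b (alpha ++ a :: beta ++ a :: gamma) = false.
Proof. by move=> ab; rewrite run_cat /= eqxx run_initial // !andbF. Qed.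

(** Labels of arbitrary type make this serve for syllable words and, with [unit] labels in
    [run_rev], for plain words. *)
Lemma runPn (T : Type) a b (u : seq (Gamma * T)) : ~~ run a b (map fst u) ->
  (b /\ exists u1 k u2, u = u1 ++ (a, k) :: u2 /\ all (adj a) (map fst u1)) \/
  (exists u0 k u1 l u2,
     u = u0 ++ (a, k) :: u1 ++ (a, l) :: u2 /\ all (adj a) (map fst u1)).
Proof.
elim: u b => //= -[x k] u IHu b /=; have [->|xa] := eqVneq x a.
  rewrite negb_and negbK; case: b => /= [_|].
    by left; split=> //; exists [::], k, u.
  move=> /IHu[[_ [s1 [l [s2 [-> s1a]]]]]|[s0 [l [s1 [l' [s2 [-> s1a]]]]]]]; right.
    by exists [::], k, s1, l, s2.
  by exists ((a, k) :: s0), l, s1, l', s2.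
move=> /IHu[[/andP[-> ax] [s1 [l [s2 [-> s1a]]]]]|[s0 [l [s1 [l' [s2 [-> s1a]]]]]]].
  by left; split=> //; exists ((x, k) :: s1), l, s2; rewrite /= ax.
by right; exists ((x, k) :: s0), l, s1, l', s2.
Qed.

(** The forbidden pattern, two letters [a] with only neighbours of [a] between them, is
    symmetric. *)
Lemma run_rev a nu : run a false nu -> run a false (rev nu).
Proof.
apply: contraLR; rewrite -{1}[rev nu](@mapK _ _ (fun x => (x, tt)) fst) //.
move=> /runPn[[]//|[s0 [k [s1 [l [s2 [nuE s1a]]]]]]].
have {nuE} : nu = rev (map fst (s0 ++ (a, k) :: s1 ++ (a, l) :: s2)).
  by rewrite -nuE (@mapK _ _ (fun x => (x, tt)) fst) // revK.
rewrite map_cat /= map_cat /= !(rev_cat, rev_cons) -!cats1 -!catA /= => ->.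
by rewrite run_factor // all_rev.
Qed.

Lemma exposedP a nu : exposed a false nu ->
  exists alpha beta, nu = alpha ++ a :: beta /\ all (adj a) beta.
Proof.
elim/last_ind: nu => // nu x IHnu.
have -> b : exposed a b (rcons nu x) = (x == a) || exposed a b nu && adj a x.
  by elim: nu b {IHnu} => //= y nu IHnu b.
case/orP => [/eqP->|/andP[/IHnu[alpha [beta [-> betaa]]] ax]].
  by exists nu, [::]; rewrite cats1.
exists alpha, (rcons beta x); split; first by rewrite -rcons_cons -rcons_cat.
by rewrite all_rcons ax.
Qed.

(** A forbidden pair would involve the middle [x] or straddle it, and in the latter case [x] would
    be a neighbour of [a]. Either way [nu] could be rearranged to start with a letter in the star of
    [x]. *)
Lemma red_sandwich x nu : red nu ->
  (forall a, (x == a) || adj x a -> run a true nu) -> red (rev nu ++ x :: nu).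
Proof.
move=> /forallP nur nua; apply/forallP => a; rewrite run_cat run_rev ?nur //=.
have [xa|xa] := eqVneq x a.
  have ra : run a true nu by rewrite nua // xa eqxx.
  rewrite ra andbT; apply/negP => /exposedP[alpha [beta [nuE ab]]].
  move: ra; rewrite -[nu]revK nuE rev_cat rev_cons cat_rcons run_initial //.
  by rewrite all_rev.
case ax: (adj a x); last by rewrite andbF nur.
by apply/run_mono/nua; rewrite adj_sym ax orbT.
Qed.

(** Cyclically reduced words; asking for all rotations makes their indicator a class function. *)
Definition cred nu := `[< forall i, red (rot i nu) >].

Lemma cred_catC alpha beta : cred (alpha ++ beta) = cred (beta ++ alpha).
Proof.
suff H nu mu : cred (nu ++ mu) -> cred (mu ++ nu) by apply/idP/idP; apply: H.
move=> /asboolP nmr; apply/asboolP => i; rewrite -rot_size_cat.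
set s := nu ++ mu in nmr *.
have [si|/ltnW si] := leqP (size s) i; first by rewrite [rot i _]rot_oversize ?size_rot.
by rewrite rot_add_mod // /s size_cat leq_addr.
Qed.

Lemma red_swap alpha beta x y : adj x y ->
  red (alpha ++ x :: y :: beta) = red (alpha ++ y :: x :: beta).
Proof. by move=> xy; apply: eq_forallb => a; rewrite run_swap. Qed.

Lemma cred_swap alpha beta x y : adj x y ->
  cred (alpha ++ x :: y :: beta) = cred (alpha ++ y :: x :: beta).
Proof.
rewrite cred_catC [RHS]cred_catC /=; set gamma := beta ++ alpha.
suff H z t : adj z t -> cred (z :: t :: gamma) -> cred (t :: z :: gamma).
  by move=> xy; apply/idP/idP; apply: H => //; rewrite adj_sym.
move=> zt /asboolP zr; apply/asboolP => -[|[|i]]; last first.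
- by have := zr i.+2; rewrite /rot /= (red_swap _ _ zt).
(* This rotation tears the pair apart, with [z] in front and [t] last. Occurrences of [z] are
   controlled by rotation 0 of the original word and those of [t] by rotation 2: the other letter of
   the pair, being a neighbour, leaves the flag unchanged. *)
- rewrite rot1_cons /= -cats1; apply/forallP => a.
  have /forallP/(_ a) r0 := zr 0%N; have /forallP/(_ a) r2 := zr 2%N.
  move: r0 r2; rewrite rot0 /rot /= drop0 take0 !run_cat /=.
  have [za|za] := eqVneq z a.
    have -> : (t == a) = false by apply: contraTF zt => /eqP->; rewrite za adj_irr.
    by rewrite -za zt => ->.
  have [ta|ta] := eqVneq t a; last by move=> + _; rewrite andbT.
  by move=> _; rewrite -ta adj_sym zt !andbT.
by have := zr 0%N; rewrite !rot0 (red_swap [::] gamma zt).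
Qed.

Lemma red_square alpha beta x : red (alpha ++ x :: x :: beta) = false.
Proof. by apply/forallP => /(_ x)/run_suffix /=; rewrite eqxx. Qed.

Lemma cred_square alpha beta x : cred (alpha ++ x :: x :: beta) = false.
Proof. by apply/asboolP => /(_ 0%N); rewrite rot0 red_square. Qed.

Definition indicator m (Q : pred (seq Gamma)) nu : int :=
  if (size nu == m) && Q nu then 1%R else 0%R.

Lemma indicator_homog m Q : homog m (indicator m Q).
Proof. by move=> nu /negPf num; rewrite /indicator num. Qed.

Lemma indicator_functional m (Q : pred (seq Gamma)) :
  (forall alpha beta x y, adj x y ->
     Q (alpha ++ x :: y :: beta) = Q (alpha ++ y :: x :: beta)) ->
  functional m (indicator m Q).
Proof.
move=> Qs; split=> [nu num|alpha beta x y xy].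
  by rewrite indicator_homog // gtn_eqF.
by rewrite /indicator (Qs _ _ _ _ xy) !size_cat.
Qed.

Lemma indicator_square_free m (Q : pred (seq Gamma)) :
  (forall alpha beta x, Q (alpha ++ x :: x :: beta) = false) ->
  square_free (indicator m Q).
Proof. by move=> Qs alpha beta x; rewrite /indicator Qs andbF. Qed.

Definition reduced s := red (map fst s) && all (fun p => p.2 != 0%R) s.

(** Two powers of [a] separated only by neighbours merge. Their exponents may add up to zero;
    [ev_reduce] removes such syllables separately. *)
Lemma ev_shorten s : ~~ red (map fst s) -> exists s', [/\ ev s' = ev s,
  (size s' < size s)%N & {subset map fst s' <= map fst s}].
Proof.
rewrite negb_forall => /existsP[a /runPn[[]//|[s0 [k [s1 [l [s2 [-> s1a]]]]]]]].
exists (s0 ++ (a, (k + l)%R) :: s1 ++ s2); split.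
- rewrite !(ev_cat, ev_cat _ (_ :: _)) /= zpowD !ev_cat /=; congr (_ * _).
  by rewrite (mulgA (ev s1)) -(ev_commute l s1a) !mulgA.
- by rewrite !size_cat /= !size_cat /=; lia.
move=> x; rewrite !map_cat /= !map_cat !(mem_cat, inE) /=.
by case/or4P=> ->; rewrite ?orbT.
Qed.

Lemma ev_reduce s : ~~ reduced s -> exists s', [/\ ev s' = ev s,
  (size s' < size s)%N & {subset map fst s' <= map fst s}].
Proof.
rewrite negb_and => /orP[/ev_shorten//|/allPn[[a k] ps]]; rewrite negbK => /= /eqP k0.
move: ps; rewrite {}k0 => /splitPr[s0 s1]; exists (s0 ++ s1); split.
- by rewrite !ev_cat /= mul1g.
- by rewrite !size_cat ltn_add2l /=.
by move=> x; rewrite !map_cat !(mem_cat, inE) => /orP[]->; rewrite ?orbT.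
Qed.

(** Since the word is reduced, the failure comes from an [a] preceded only by neighbours, which can
    be pulled to the front. *)
Lemma ev_initial a s : red (map fst s) -> ~~ run a true (map fst s) ->
  exists k s', [/\ ev s = zpow (gen a) k * ev s', (size s' < size s)%N,
    a \in map fst s & {subset map fst s' <= map fst s}].
Proof.
move=> /forallP/(_ a) sr /runPn[[_ [s1 [k [s2 [sE s1a]]]]]|]; last first.
  move=> [s0 [k [s1 [l [s2 [sE s1a]]]]]]; move: sr; rewrite sE map_cat /= map_cat.
  by rewrite run_factor.
exists k, (s1 ++ s2); rewrite sE; split.
- by rewrite !ev_cat /= !mulgA (ev_commute _ s1a).
- by rewrite !size_cat ltn_add2l /=.
- by rewrite map_cat mem_cat inE eqxx orbT.
by move=> x; rewrite !map_cat !(mem_cat, inE) => /orP[]->; rewrite ?orbT.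
Qed.

(** Here [m] counts the syllables of [s^-1 x s], and the value is, up to sign, the product of the
    squared exponents of [s]. *)
Lemma act_sandwich x s (f : seq Gamma -> int) (m := (size s).*2.+1) :
  functional m f -> square_free f -> homog m f -> reduced s ->
  f (rev (map fst s) ++ x :: map fst s) = 1%R ->
  act m (gen x ^ ev s) f [::] != 0%R.
Proof.
move=> fP fsq fh /andP[_ s0] f1.
have -> : gen x ^ ev s = ev (syl_inv s ++ (x, 1%R) :: s) by rewrite ev_cat ev_inv.
rewrite act_ev //; last by rewrite size_cat size_rev size_map /= addnS add0n addnn.
rewrite map_cat map_fst_syl_inv f1 mulr1.
rewrite prodf_seq_neq0 all_cat all_rev all_map /= s0 !andbT.
by apply: sub_all s0 => p /=; rewrite oppr_eq0.
Qed.

End ReducedWords.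

(** * Automorphisms of finite order *)

Lemma size_minimal (T : Type) (P : seq T -> Prop) : (exists s, P s) ->
  exists s, P s /\ forall s', P s' -> (size s <= size s')%N.
Proof.
move=> [s0 Ps0].
have exP : exists n, `[< exists s, P s /\ size s = n >].
  by exists (size s0); apply/asboolP; exists s0.
case: (ex_minnP exP) => n /asboolP[s [Ps <-]] smin; exists s; split=> // s' Ps'.
by apply: smin; apply/asboolP; exists s'.
Qed.

Section FiniteOrder.
Variable Gamma : sgraph.
Local Notation G := (raag Gamma).
Local Notation gen := (@raag_gen Gamma).
Implicit Types (a v x : Gamma) (L : seq Gamma) (s : seq (Gamma * int)) (phi : Aut G).

Definition in_star v x := (v == x) || adj v x.

Definition in_stars L x := all (fun v => in_star v x) L.

Lemma in_star_commute v x : in_star v x -> commute (gen v) (gen x).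
Proof. by case/orP=> [/eqP->|/adj_commute]. Qed.

Lemma in_stars_commute L v x : v \in L -> in_stars L x -> commute (gen v) (gen x).
Proof. by move=> vL /allP/(_ v vL)/in_star_commute. Qed.

(* Up to an element of [in_stars (v :: L)], [c] is given by a reduced word [s]
   without initial letter in the star of [v]; then the conjugate of [v] by [c]
   is reduced as written, and it equals [v] only if [s] is empty. *)
Lemma centralizer_in_stars L c :
  (forall v, v \in L -> commute (gen v) c) -> lgen (in_stars L) c.
Proof.
elim: L => [_|v L IHL cL]; first exact: lgenT.
have {IHL} : lgen (in_stars L) c by apply: IHL => x xL; apply: cL; rewrite inE xL orbT.
move=> /lgen_ev[s0 s0L cE].
pose P s := all (in_stars L) (map fst s) /\
  exists2 t, lgen (in_stars (v :: L)) t & t * c = ev s.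
have [|s [[sL [t tL tc]] smin]] := @size_minimal _ P.
  by exists s0; split=> //; exists 1; [apply: lgen1 | rewrite mul1g].
have sred : reduced s.
  apply: contraT => /ev_reduce[s' [s'E s's s'sub]]; have := s's.
  rewrite ltnNge smin //; split; last by exists t; rewrite // s'E.
  by apply/allP => x /s'sub; apply: allP.
have sinit a : in_star v a -> run a true (map fst s).
  move=> va; apply: contraT => /(ev_initial (proj1 (andP sred))).
  move=> [k [s' [sE s's a_s s'sub]]]; have := s's.
  rewrite ltnNge smin //; split; first by apply/allP => x /s'sub; apply: allP.
  exists (zpow (gen a) (- k)%R * t).
    by apply: lgenM tL; apply: lgen_zpow; rewrite /= va; apply: (allP sL).
  by rewrite -mulgA tc sE zpowN mulKg.
have [s_nil|s_gt0] := posnP (size s).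
  rewrite -[c](mulKg t) tc (size0nil s_nil) mulg1; exact: lgenV.
pose m := (size s).*2.+1; pose f := indicator m (@red Gamma).
have fP : functional m f by apply: indicator_functional => *; apply: red_swap.
have fh : homog m f := @indicator_homog _ m _.
have fsq : square_free f by apply: indicator_square_free => *; apply: red_square.
have /eqP[] : act m (gen v ^ ev s) f [::] != 0%R.
  apply: act_sandwich => //; rewrite /f /indicator size_cat size_rev /= !size_map.
  by rewrite addnS addnn eqxx red_sandwich // (proj1 (andP sred)).
have -> : gen v ^ ev s = gen v.
  apply/conjg_fixP/commgP; rewrite -tc.
  apply: commuteM; last by apply: cL; rewrite mem_head.
  by apply: lgen_commute tL => x; apply: in_stars_commute; rewrite mem_head.
(* The expansion of [v] has degree one, whereas [m] is at least 3. *)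
by rewrite act_gen // !fh //= /m eqSS eq_sym double_eq0 -lt0n.
Qed.

Lemma act_class_conj m f (g d : G) : functional m f ->
  (forall alpha beta, f (alpha ++ beta) = f (beta ++ alpha)) ->
  act m (g ^ d) f [::] = act m g f [::].
Proof. by move=> fP fC; rewrite /conjg act_class_function // mulgK. Qed.

Section OuterTorsion.
Variables (phi : Aut G) (n : nat) (c : G).
Hypotheses (n_gt0 : (0 < n)%N) (phin : forall g : G, (phi ^+ n) g = g ^ c)
  (phiD : forall g : G, g^-1 * phi g \in derived G).

Lemma aut_gen_conj v : exists g, phi (gen v) = gen v ^ g.
Proof.
pose P s := exists g, phi (gen v) ^ g = ev s.
have [|s [[g gE] smin]] := @size_minimal _ P.
  by have [s _ sE] := lgen_ev (lgenT (phi (gen v))); exists s, 1; rewrite conjg1.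
have sred : reduced s.
  apply: contraT => /ev_reduce[s' [s'E s's _]]; have := s's.
  by rewrite ltnNge smin //; exists g; rewrite gE.
have class_eq m f : functional m f ->
    (forall alpha beta, f (alpha ++ beta) = f (beta ++ alpha)) ->
    act m (ev s) f [::] = (f [::] + f [:: v])%R.
  move=> fP fC; rewrite -gE (act_fixed n_gt0 phiD phin) //.
    by rewrite act_class_conj // act_gen.
  by move=> i; rewrite !act_class_conj.
have [s_le1|s_gt1] := leqP (size s) 1%N.
  (* This reads off the exponent of [v] in homology, which forces the only syllable to be
     [(v, 1)]. *)
  pose f := indicator 1%N (pred1 [:: v]).
  have f_swap alpha beta x y : (alpha ++ [:: x, y & beta] == [:: v]) = false.
    by apply/eqP => /(congr1 size); rewrite size_cat /= !addnS.
  have fP : functional 1%N f by apply: indicator_functional => *; rewrite /= !f_swap.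
  have fsq : square_free f by apply: indicator_square_free => *; apply: f_swap.
  have fC alpha beta : f (alpha ++ beta) = f (beta ++ alpha).
    rewrite /f /indicator !size_cat addnC.
    by case: alpha beta => [|x [|y alpha]] [|z [|t beta]].
  have := class_eq 1%N f fP fC; rewrite {2 3}/f {1 2}/indicator /= eqxx.
  move: gE; case: (s) s_le1 => [|[y k] []] //= _ gE; first by rewrite act1.
  rewrite mulg1 in gE *; rewrite act_zpow // /f /indicator /= add0r.
  have [[yv]|] := eqVneq [:: y] [:: v]; last by rewrite mulr0.
  by rewrite mulr1 => k1; exists g^-1; rewrite -(conjgK g (phi _)) gE yv k1.
(* The value at [v] is zero since [m] is at least 2. If [s] is cyclically reduced, the value at
   [ev s] is the product of its nonzero exponents. *)
pose m := size s; pose f := indicator m (@cred Gamma).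
have fP : functional m f by apply: indicator_functional => *; apply: cred_swap.
have fh : homog m f := @indicator_homog _ m _.
have fsq : square_free f by apply: indicator_square_free => *; apply: cred_square.
have fC alpha beta : f (alpha ++ beta) = f (beta ++ alpha).
  by rewrite /f /indicator cred_catC !size_cat addnC.
have := class_eq m f fP fC; rewrite !fh ?ltn_eqF //; last exact: ltnW.
rewrite act_ev // addr0 => /eqP; rewrite mulf_eq0 prodf_seq_eq0.
have /andP[_ s0] := sred; rewrite -[has _ _]negbK -all_predC s0 /=.
rewrite /f /indicator size_map eqxx /=; case: ifP => // /asboolP[] i.
(* A rotation of [s] represents a conjugate, by [ev (take i s)], so shortening it would contradict
   minimality. *)
apply: contraT; rewrite -map_rot => /ev_shorten[s' [s'E]].
rewrite size_rot ltnNge smin //; exists (g * ev (take i s)).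
rewrite conjgM gE s'E /rot ev_cat -{1}(cat_take_drop i s) ev_cat.
by rewrite /conjg -mulgA mulKg.
Qed.

Lemma aut_fix_extend L w : (forall v, v \in L -> phi (gen v) = gen v) ->
  exists2 r, forall v, v \in L -> commute (gen v) r & phi (gen w) = gen w ^ r.
Proof.
move=> phiL; have [g gE] := aut_gen_conj w.
have cL : lgen (in_stars L) c.
  apply: centralizer_in_stars => v vL; apply/commgP/conjg_fixP; rewrite -phin.
  elim: (n) => [|k IHk]; first by rewrite expg0 aut1E.
  by rewrite expgS autME IHk phiL.
pose P s := exists t r, [/\ lgen (in_star w) t, lgen (in_stars L) r & t * g * r = ev s].
have [|s [[t [r [tw rL tgr]]] smin]] := @size_minimal _ P.
  have [s _ sE] := lgen_ev (lgenT g); exists s, 1, 1.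
  by rewrite mul1g mulg1; split=> //; apply: lgen1.
have sred : reduced s.
  apply: contraT => /ev_reduce[s' [s'E s's _]]; have := s's.
  by rewrite ltnNge smin //; exists t, r; rewrite s'E.
have sinit a : in_star w a -> run a true (map fst s).
  move=> wa; apply: contraT => /(ev_initial (proj1 (andP sred))).
  move=> [k [s' [sE s's _ _]]]; have := s's.
  rewrite ltnNge smin //; exists (zpow (gen a) (- k)%R * t), r; split=> //.
    by apply: lgenM tw; apply: lgen_zpow.
  by rewrite -!mulgA (mulgA t) tgr sE zpowN mulKg.
have wt : gen w ^ t = gen w.
  by apply/conjg_fixP/commgP; apply: lgen_commute tw => x; apply: in_star_commute.
have sE : gen w ^ ev s = phi (gen w) ^ r by rewrite -tgr !conjgM wt -gE.
have [s_nil|] := posnP (size s).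
  exists r^-1; last by rewrite -(conjgK r (phi _)) -sE (size0nil s_nil) conjg1.
  move=> v vL; apply: lgen_commute (lgenV rL) => x; exact: in_stars_commute.
case/lastP: s => // s [a k] in smin tgr sred sinit sE * => _.
(* Otherwise the last syllable could be absorbed into [r]. As [a] occurs on both sides of [w] in the
   sandwich, it provides the two outside letters demanded by [Q]. *)
have aL : ~~ in_stars L a.
  apply/negP => aL; suff /smin : P s by rewrite size_rcons ltnn.
  exists t, (r * zpow (gen a) (- k)%R); split=> //.
    by apply: lgenM rL _; apply: lgen_zpow.
  by rewrite mulgA tgr -cats1 ev_cat /= mulg1 zpowN mulgK.
set u := rcons s (a, k) in smin tgr sred sinit sE *.
pose m := (size u).*2.+1.
pose Q nu := red nu && (1 < count (predC (in_stars L)) nu)%N.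
pose f := indicator m Q.
have fP : functional m f.
  by apply: indicator_functional => *; rewrite /Q red_swap // !count_cat /=;
    congr (_ && (1 < _)%N); lia.
have fsq : square_free f.
  by apply: indicator_square_free => *; rewrite /Q red_square.
have f1 : few_outside (in_stars L) 1%N f.
  by move=> nu nu1; rewrite /f /indicator /Q ltnNge nu1 !andbF.
have /eqP[] : act m (gen w ^ ev u) f [::] != 0%R.
  apply: act_sandwich => //; first exact: indicator_homog.
  rewrite /f /indicator size_cat size_rev /= !size_map addnS addnn eqxx /Q.
  rewrite red_sandwich ?(proj1 (andP sred)) //= count_cat count_rev /=.
  by rewrite /u map_rcons -cats1 count_cat /= aL ifT //; lia.
have act0 d : lgen (in_stars L) d -> act m (gen w ^ d) f [::] = 0%R.
  by move=> dL; apply: act_conj_few_outside dL _ f1.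
(* Taking [d = r], every conjugator [c ^+ i * r] stays in the subgroup generated by [in_stars L], so
   all the values compared vanish. *)
rewrite sE (act_fixed n_gt0 phiD phin) // ?act0 // => i.
apply: act0; apply: lgenM rL.
by elim: i => [|i IHi]; rewrite ?expgS; [apply: lgen1|apply: lgenM].
Qed.

End OuterTorsion.

Lemma torsion_torelli_inner phi n : (0 < n)%N -> phi ^+ n \in Inn G ->
  (forall g : G, g^-1 * phi g \in derived G) -> phi \in Inn G.
Proof.
move=> n_gt0 phinI phiD.
have conjL L : exists d, forall v, v \in L -> phi (gen v) = gen v ^ d.
  elim: L => [|w L [d dL]]; first by exists 1.
  (* Undoing the conjugation by [d] gives an automorphism in the same outer class that fixes every
     generator in [L]. *)
  pose psi := inner_aut d^-1 * phi.
  have psiE (g : G) : psi g = phi g ^ d^-1 by [].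
  have /asboolP[c psin] : psi ^+ n \in Inn G.
    apply/quotg_proj_inner; rewrite gmulfXn gmulfM /=.
    rewrite (quotg_proj_inner _).2 ?inner_aut_inner // mul1g -gmulfXn.
    exact/quotg_proj_inner.
  have psiD (g : G) : g^-1 * psi g \in derived G.
    rewrite psiE -[phi g ^ _](mulVKg (phi g)) -commgEl mulgA.
    by apply: nsubM; [apply: phiD | apply: derived_comm].
  have psiL v : v \in L -> psi (gen v) = gen v by move=> vL; rewrite psiE dL ?conjgK.
  have [r rL rw] := aut_fix_extend n_gt0 psin psiD w psiL.
  (* Conjugation by [r] does not disturb [L], so it agrees with [psi] on [w] and on [L]; conjugating
     by [d] returns to [phi]. *)
  exists (r * d) => v; rewrite inE conjgM => /orP[/eqP->|vL].
    by rewrite -rw psiE conjgKV.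
  by rewrite (_ : gen v ^ r = gen v) ?dL //; apply/conjg_fixP/commgP/rL.
have [d dE] := conjL (enum Gamma); apply/asboolP; exists d => x.
pattern x; apply: gen_subgroup_ind x => [|x y IHx IHy|x IHx|v].
- by rewrite gmulf1 conj1g.
- by rewrite autM IHx IHy conjMg.
- by rewrite gmulfV /= IHx conjVg.
by apply: dE; rewrite mem_enum.
Qed.

End FiniteOrder.

(** * Passage to outer automorphisms and the Torelli subgroup *)

Lemma finite_order_acts_trivially (Gamma : sgraph) (phi : Out (raag Gamma)) :
  finite_order phi -> acts_trivially phi -> phi = 1.
Proof.
move=> [n n_gt0 phin] phiH1; rewrite -[phi]quotg_projK; apply/quotg_proj_inner.
apply: (torsion_torelli_inner n_gt0) => [|x].
  by apply/quotg_proj_inner; rewrite gmulfXn /= quotg_projK.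
have := phiH1 (H1_proj x); rewrite /out_H1 aut_H1E => /esym.
by move/quotg_projP.
Qed.

Theorem theorem1p3 (Gamma : sgraph) :
  (forall phi : Out (raag Gamma),
      phi <> 1 -> finite_order phi -> ~ acts_trivially phi) /\
  torsion_free (Torelli (raag Gamma)).
Proof.
split=> [phi phi1 phi_fin phiH1|phi [n n_gt0 phin]].
  exact/phi1/finite_order_acts_trivially.
apply: val_inj; rewrite val1; apply: finite_order_acts_trivially.
  by exists n; rewrite // -gmulfXn phin gmulf1.
exact/asboolP/(valP phi).
Qed.
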